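(* Assume that $(A,B)$ is an attractor-repeller pair for a semiflow relation $\Phi$ on a compact metric space $X$. There exists a continuous function $L: X \to [0,1]$ with $B = L^{-1}(0)$, $A = L^{-1}(1)$ and such that if $(x,y) \in \phi^I \cup \mathcal{C}(\phi^J)$ with $x \neq y$, then $L(y) \ge L(x)$ with equality only when $x,y \in A$ or $x,y \in B$. In particular, $L$ is a Lyapunov function for $\mathcal{C}(\phi^J)$ with $|L| = A \cup B$. Furthermore, for all $a$ such that $0 < a < 1$, the set $U_a = \{ x : L(x) \ge a \}$ is an inward subset for $\Phi$ with associated attractor $A$. If $V$ is any neighborhood of $A$, there exists $0 < a < 1$ such that $U_a \subset V$.
   Context: A relation on $X$ is a subset $R\subset X\times X$, closed if a closed subset; $R(x)=\{y:(x,y)\in R\}$, $R(A)=\bigcup_{x\in A}R(x)$, $R^{-1}=\{(y,x):(x,y)\in R\}$, $R^n$ the $n$-fold composition, $R^{-n}=(R^{-1})^n$. A semiflow relation on $X$ is a closed subset $\Phi\subset X\times[0,\infty)\times X$ such that, with $\phi^t=\{(x,y):(x,t,y)\in\Phi\}$: $\phi^0$ is the diagonal $1_X$, and $\phi^{t_1}\circ\phi^{t_2}=\phi^{t_1+t_2}$ for all $t_1,t_2\ge0$. For compact $K\subset[0,\infty)$, $\phi^K=\bigcup_{t\in K}\phi^t$; $I=[0,1]$, $J=[1,2]$. $\mathcal{C}R=\bigcap_{\epsilon>0}\mathcal{O}(V_\epsilon\circ R)$ where $\mathcal{O}Q=\bigcup_{n\ge1}Q^n$ and $V_\epsilon=\{(x,y):d(x,y)<\epsilon\}$.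 $(A,B)$ is an attractor-repeller pair for $\Phi$ if it is one for the closed relation $\phi^J$: there is a closed $U\subset X$ with $\phi^J(U)\subset U^\circ$ (i.e. $U$ inward for $\phi^J$) such that $A=\bigcap_{n\ge1}(\phi^J)^n(U)$ (the attractor associated with $U$) and $B=\bigcap_{n\ge1}(\phi^J)^{-n}(X\setminus U^\circ)$. A closed set $U$ is inward for $\Phi$ if $\phi^t(U)\subset U^\circ$ for every $t>0$; its associated attractor is $\bigcap_{n\ge 1}(\phi^J)^n(U)$. A continuous $L:X\to\mathbb{R}$ is a Lyapunov function for $R$ if $(x,y)\in R$ implies $L(x)\le L(y)$. $|L|$ is the set of critical points of $L$ with respect to $R$ (here $R=\mathcal{C}(\phi^J)$), i.e. the points $x$ for which $\sup L|R^{-1}(x)<L(x)<\inf L|R(x)$ fails ($\sup\emptyset=-\infty$, $\inf\emptyset=\infty$). *)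

(* Defs.v *)
From mathcomp Require Import all_boot all_order all_algebra.
From mathcomp Require Import all_classical all_reals all_analysis.

Set Implicit Arguments.
Unset Strict Implicit.
Unset Printing Implicit Defensive.

Import Order.TTheory GRing.Theory Num.Theory.
Import numFieldNormedType.Exports.

Local Open Scope classical_set_scope.
Local Open Scope ring_scope.
Local Open Scope relation_scope.

(* Relations on X are sets of pairs.  R(x) is [xsection R x] and R^{-1} is
   [R^-1].  Pitfall: [S \; R] relates along R first and along S next, so it is
   the usual composition S \circ R. *)

Definition rel_image {X : Type} (R : set (X * X)) (A : set X) : set X :=
  \bigcup_(x in A) xsection R x.

Definition rel_iter {X : Type} (R : set (X * X)) (n : nat) : set (X * X) :=
  iter n (fun Q : set (X * X) => R \; Q) diagonal.

Definition orbit_rel {X : Type} (R : set (X * X)) : set (X * X) :=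
  \bigcup_(n >= 1) rel_iter R n.

Definition mdist_rel {R : realType} {X : metricType R} (e : R) : set (X * X) :=
  [set xy | mdist xy.1 xy.2 < e].

(* Conley's chain relation: the intersection over e > 0 of O(V_e \circ Q). *)
Definition chain_rel {R : realType} {X : metricType R} (Q : set (X * X)) :
    set (X * X) :=
  \bigcap_(e in [set e : R | 0 < e]) orbit_rel (mdist_rel e \; Q).

Definition inward {X : topologicalType} (R : set (X * X)) (U : set X) : Prop :=
  closed U /\ rel_image R U `<=` U°.

Definition attractor_of {X : Type} (R : set (X * X)) (U : set X) : set X :=
  \bigcap_(n >= 1) rel_image (rel_iter R n) U.

Definition repeller_of {X : topologicalType} (R : set (X * X)) (U : set X) :
    set X :=
  \bigcap_(n >= 1) rel_image (rel_iter R^-1 n) (~` U°).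

Definition attractor_repeller_pair {X : topologicalType} (R : set (X * X))
    (A B : set X) : Prop :=
  exists U : set X,
    [/\ inward R U, A = attractor_of R U & B = repeller_of R U].

Definition lyapunov {R : realType} {X : topologicalType} (Q : set (X * X))
    (L : X -> R) : Prop :=
  continuous L /\ forall x y, Q (x, y) -> L x <= L y.

(* The extended-real conventions sup \emptyset = -oo and inf \emptyset = +oo
   are those of [ereal_sup] and [ereal_inf]. *)
Definition critical_points {R : realType} {X : Type} (Q : set (X * X))
    (L : X -> R) : set X :=
  [set x | ~ ((ereal_sup [set (L y)%:E | y in xsection (Q^-1)%relation x]
                 < (L x)%:E)%E
              /\ ((L x)%:E < ereal_inf [set (L y)%:E | y in xsection Q x])%E)].

Definition time_rel {R : realType} {X : Type} (Phi : set (X * R * X)) (t : R) :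
    set (X * X) :=
  [set xy | Phi (xy.1, t, xy.2)].

Definition times_rel {R : realType} {X : Type} (Phi : set (X * R * X))
    (K : set R) : set (X * X) :=
  \bigcup_(t in K) time_rel Phi t.

(* A subset of X * [0, +oo[ * X is a subset of X * R * X whose times are
   nonnegative; closedness means the same in both, [0, +oo[ being closed. *)
Record semiflow_relation {R : realType} {X : topologicalType}
    (Phi : set (X * R * X)) : Prop := SemiflowRelation {
  semiflow_closed : closed Phi;
  semiflow_time_ge0 : forall (x : X) (t : R) (y : X), Phi (x, t, y) -> 0 <= t;
  semiflow_time0 : time_rel Phi 0 = diagonal;
  semiflow_timeD : forall t1 t2 : R, 0 <= t1 -> 0 <= t2 ->
    time_rel Phi t1 \; time_rel Phi t2 = time_rel Phi (t1 + t2)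
}.

Definition semiflow_inward {R : realType} {X : topologicalType}
    (Phi : set (X * R * X)) (U : set X) : Prop :=
  closed U /\ forall t : R, 0 < t -> rel_image (time_rel Phi t) U `<=` U°.

(* Main.v *)
From HB Require Import structures.
Require Import Defs.
From mathcomp Require Import all_boot all_order all_algebra.
From mathcomp Require Import all_classical all_reals all_analysis.
From mathcomp Require Import lra.
Import Order.TTheory GRing.Theory Num.Theory.
Import numFieldNormedType.Exports.

Set Implicit Arguments.
Unset Strict Implicit.
Unset Printing Implicit Defensive.

Local Open Scope classical_set_scope.
Local Open Scope ring_scope.

(** Write F for the closed relation phi^J and G for the union of phi^I and
    the chain relation C F.  Apart from the values of L on A and B, the
    theorem rests on one property, strict monotonicity along G outside A and
    B, so the proof treats G as an order on X.

    G is a closed preorder.  Reflexivity is phi^0 = 1_X.  Transitivity holds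
    because a piece of orbit put before or after an F-step is again a
    sequence of F-steps, once its length is cut into pieces of length in
    [1,2].  To append it at the end of a chain one first has to remove the
    last jump; this is what [chain_last] does: by compactness, and because F
    is closed, a pair of C F is either a pair of F or ends with an exact
    F-step.  The same lemma shows that C F maps the n-th iterate of an
    inward set into the (n+1)-st one, which makes A stable under C F
    ([chain_attractor]), and that the inverse of C F is contained in C(F^-1)
    ([chain_inv]).  Since B is by definition the attractor of F^-1
    associated with the complement of the interior of U, every fact about B
    is a fact about attractors read backwards.  The upshot
    ([attractor_repeller_props]): A and B are closed and disjoint, A is
    increasing and B is decreasing for G, and a point x with (x,x) in C F
    belongs to A or B.

    The analytic input is a strict form of Nachbin's theorem on ordered
    spaces ([strictly_monotone_function]): for a closed preorder on a
    compact metric space and disjoint closed sets A increasing and B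
    decreasing, there is a continuous monotone L with zero set B, with value
    1 exactly on A, and with L x < L y whenever (x,y) is in the preorder,
    (y,x) is not, x is outside A and y is outside B.  It is a dyadic sum of
    monotone Urysohn functions ([order_urysohn]), one for each pair of sets
    of a countable basis.

    Strictness for the theorem follows: if (x,y) and (y,x) are both in G and
    x <> y, then x is chain recurrent, because two orbit pieces between
    distinct points make a nontrivial periodic orbit, and a chain closed up
    by an orbit piece or by a chain is a chain; hence x and y are together
    in A or together in B.  The attractor of a superlevel set of L
    is found by looking at a point where L is minimal on it: this point has
    a preimage in the attractor, L cannot increase from the preimage to the
    point, so the point is in A and the minimum is 1. *)

(** * Compactness, closed relations and dyadic approximation *)

(** The tube lemma, in the form of a projection along a compact factor:
    images of closed sets under closed relations and unions of time slices
    of a semiflow over a compact set of times are instances. *)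
Lemma closed_compact_proj (T Y : topologicalType) (K : set T)
    (S : set (T * Y)) :
  compact K -> closed S -> closed [set y | exists2 t, K t & S (t, y)].
Proof.
move=> /compact_near_coveringP cK cS; rewrite -[X in closed X]setCK.
apply: open_closedC; rewrite openE => y /= ny.
have Ky : \forall y' \near y, K `<=` (fun t => ~ S (t, y')).
  apply: cK => t Kt; have : nbhs (t, y) (~` S).
    apply: open_nbhs_nbhs; split; first exact: closed_openC.
    by move=> Sty; apply: ny; exists t.
  by case=> -[U V] [/= nU nV] UV; exists (U, V) => // -[t' y'] /UV.
by apply: filterS Ky => y' Ky' [t Kt]; exact: Ky'.
Qed.

Lemma closed_rel_image (T : topologicalType) (G : set (T * T)) (N : set T) :
  compact [set: T] -> closed G -> closed N -> closed (rel_image G N).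
Proof.
move=> cT cG cN.
have cNc : compact N by exact: subclosed_compact cT _.
have := closed_compact_proj cNc cG; congr (closed _).
apply/seteqP; split=> y /= [x Nx]; last by move/xsectionP; exists x.
by move=> Gxy; exists x => //; exact/xsectionP.
Qed.

Lemma inv_closed (T : topologicalType) (G : set (T * T)) :
  closed G -> closed (G^-1)%relation.
Proof.
move=> cG; rewrite (_ : (G^-1)%relation =
  (fun xy : T * T => (xy.2, xy.1)) @^-1` G)//.
apply: preimage_closed => // xy _.
apply: cvg_pair; [exact: cvg_snd|exact: cvg_fst].
Qed.

(** The empty set is put in position 0 so that a pair of members of the
    enumeration can also constrain one side only. *)
Lemma compact_enum_basis {R : realType} (X : metricType R) :
  compact [set: X] ->
  exists e : nat -> set X, e 0%N = set0 /\
    forall x P, nbhs x P -> exists n, e n x /\ e n `<=` P.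
Proof.
move=> cX; have [[x0 _]|X0] := pselect (exists x : X, True); last first.
  by exists (fun=> set0); split => // x; case: X0; exists x.
pose Xp : pseudoPMetricType R :=
  HB.pack_for (pseudoPMetricType R) (Metric.sort X) (isPointed.Build X x0).
have [B cB [_ basisB]] := @compact_second_countable R Xp cX.
have /pfcard_geP[B0|[f]] := cB.
  exists (fun=> set0); split => // x P /basisB[U [+ _] _].
  by rewrite B0.
exists (fun n => if n is n'.+1 then f n' else set0); split => // x P.
move=> /basisB[U [BU Ux] UP]; have [n _ fn] := @surj _ _ _ _ f U BU.
by exists n.+1; rewrite fn.
Qed.

Lemma pow2_half {R : realType} (n : nat) : 2 ^- n.+1 = 2 ^- n / 2 :> R.
Proof. by rewrite exprS invfM mulrC. Qed.

Lemma pow2_inv_gt0 {R : realType} (n : nat) : 0 < 2 ^- n :> R.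
Proof. by rewrite invr_gt0 exprn_gt0. Qed.

Lemma pow2_inv_small {R : realType} (e : R) : 0 < e -> exists n, 2 ^- n < e.
Proof.
move=> e0; have := near_infty_natSinv_expn_lt (PosNum e0).
by move=> [n _ /(_ n (leqnn n))] /=; rewrite div1r; exists n.
Qed.

Lemma ler_addpow2 {R : realType} (a b : R) :
  (forall n, a <= b + 2 ^- n) -> a <= b.
Proof.
move=> ab; apply/ler_addgt0Pl => e /pow2_inv_small[n ne].
by rewrite addrC (le_trans (ab n))// lerD2l ltW.
Qed.

Section dyadic_limit.
Context {R : realType} {T : topologicalType} (F : nat -> T -> R).

(** The limit exists as a pointwise supremum, since the approximations
    increase; the error bound is what transports continuity and inequalities
    to it. *)
Lemma dyadic_limit :
  (forall n k x, F n x <= F (n + k)%N x <= F n x + 2 ^- n) ->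
  exists L : T -> R, forall n x, F n x <= L x <= F n x + 2 ^- n.
Proof.
move=> HF; exists (fun x => sup (range (F ^~ x))) => n x.
have Fle m : F m x <= F n x + 2 ^- n.
  have [nm|mn] := leqP n m.
    by have /andP[_] := HF n (m - n)%N x; rewrite subnKC.
  have /andP[+ _] := HF m (n - m)%N x; rewrite subnKC ?(ltnW mn)// => Fmn.
  by have := @pow2_inv_gt0 R n; lra.
apply/andP; split.
  apply: ub_le_sup; last by exists n.
  by exists (F n x + 2 ^- n) => _ [m _ <-].
apply: ge_sup; first by exists (F n x), n.
by move=> _ [m _ <-].
Qed.

(** The approximations themselves may jump: it is enough that the n-th one
    oscillates, near each point, by no more than the error bound. *)
Lemma dyadic_limit_continuous (L : T -> R) :
  (forall n x, F n x <= L x <= F n x + 2 ^- n) ->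
  (forall n x, \forall y \near x, `|F n y - F n x| <= 2 ^- n) ->
  continuous L.
Proof.
move=> FL osc x; apply/cvgrPdist_lt => e e0.
have [n ne] := @pow2_inv_small R (e / 2) (divr_gt0 e0 (ltr0Sn _ 1)).
apply: filterS (osc n x) => y; rewrite ler_norml => /andP[H1 H2].
have /andP[H3 H4] := FL n x; have /andP[H5 H6] := FL n y.
by rewrite ltr_norml; apply/andP; split; lra.
Qed.

End dyadic_limit.

(** * An order-preserving Urysohn lemma *)

Definition up_closed {T : Type} (G : set (T * T)) (C : set T) :=
  forall x y, G (x, y) -> C x -> C y.

Section order_urysohn.
Context {R : realType} {T : topologicalType} (G : set (T * T)).
Hypotheses (compactT : compact [set: T]) (hausdorffT : hausdorff_space T).
Hypotheses (closedG : closed G) (reflG : forall x, G (x, x)).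
Hypothesis transG : forall x y z, G (x, y) -> G (y, z) -> G (x, z).

Let nested (p : set T * set T) :=
  [/\ closed p.1, open p.2, up_closed G p.1, up_closed G p.2 & p.1 `<=` p.2].

(** Interpolation between a closed increasing set and an open increasing
    neighborhood of it.  By normality there is a closed N in between; its
    increasing hull q.1 is closed and stays in the neighborhood, and the
    largest increasing set inside the interior of N is the open q.2. *)
Lemma up_closed_interpolate p : nested p -> exists q,
  [/\ nested (p.1, q.2), nested (q.1, p.2) & q.2 `<=` q.1].
Proof.
case: p => C W [/= cC oW upC upW CW].
have [N [cN CN NW]] : exists N, [/\ closed N, C `<=` N° & N `<=` W].
  have CnW : set_nbhs C W by move=> x /CW Wx; exact: open_nbhs_nbhs.
  have [N CN NW] := compact_normal hausdorffT compactT cC CnW.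
  exists (closure N); split => //; first exact: closed_closure.
  by move=> x /CN; apply: filterS; exact: subset_closure.
pose C' := rel_image G N; pose W' := ~` rel_image (G^-1)%relation (~` N°).
have cC' : closed C' by exact: closed_rel_image.
have oW' : open W'.
  apply/closed_openC/closed_rel_image => //; first exact: inv_closed.
  exact/open_closedC/open_interior.
have inW' x : W' x -> N° x.
  move=> W'x; apply: contrapT => Nx; apply: W'x; exists x => //.
  exact/xsectionP.
have upC' : up_closed G C'.
  move=> x y Gxy [z Nz /xsectionP Gzx]; exists z => //.
  by apply/xsectionP; exact: transG Gzx Gxy.
have upW' : up_closed G W'.
  move=> x y Gxy W'x [z Nz /xsectionP/= Gyz]; apply: W'x; exists z => //.
  by apply/xsectionP; exact: transG Gxy Gyz.
exists (C', W'); split; [split => //=|split => //=|].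
- by move=> x Cx [z Nz /xsectionP/= Gxz]; apply: Nz; exact/CN/(upC _ _ Gxz).
- by move=> x [z /NW Wz /xsectionP Gzx]; exact: upW _ _ Gzx Wz.
- move=> x /inW'/interior_subset Nx; exists x => //; exact/xsectionP.
Qed.

Section step_functions.
Variable mid : set T * set T -> set T * set T.
Hypothesis midP : forall p, nested p ->
  [/\ nested (p.1, (mid p).2), nested ((mid p).1, p.2) &
      (mid p).2 `<=` (mid p).1].

(** The n-th dyadic approximation of the Urysohn function of a nested pair.
    The interpolating pair (W', C') splits (C, W) into (C, W') and (C', W),
    which carry the upper and the lower half of the values.  At each point
    one of the two has reached its extreme value: the first vanishes off W',
    the second is 1 on C', and W' is inside C'.  This is why errors and
    oscillations are halved at each stage. *)
Fixpoint step (n : nat) (p : set T * set T) (x : T) : R :=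
  if n is m.+1
  then (step m (p.1, (mid p).2) x + step m ((mid p).1, p.2) x) / 2
  else \1_p.1 x.

Lemma step01 n p x : 0 <= step n p x <= 1.
Proof.
elim: n p => [p|n IH p] /=; first by rewrite indicE ler0n lern1 leq_b1.
by have := IH (p.1, (mid p).2); have := IH ((mid p).1, p.2); lra.
Qed.

Lemma step_in n p x : nested p -> p.1 x -> step n p x = 1.
Proof.
elim: n p => [p _ px|n IH p np px] /=; first by rewrite indicE mem_set.
have [n1 n2 m21] := midP np; rewrite !IH//=; first lra.
by have [_ _ _ _] := n1; move=> /(_ x px)/m21.
Qed.

Lemma step_out n p x : nested p -> ~ p.2 x -> step n p x = 0.
Proof.
elim: n p => [p [_ _ _ _ p12] px|n IH p np px] /=.
  by rewrite indicE memNset// => /p12.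
have [n1 n2 m21] := midP np; rewrite !IH//=; first lra.
by have [_ _ _ _ n2S] := n2 => /m21/n2S.
Qed.

Lemma step_homo n p x y : nested p -> G (x, y) -> step n p x <= step n p y.
Proof.
move=> + Gxy; elim: n p => [p [_ _ up _ _]|n IH p np] /=.
  rewrite !indicE; have [/set_mem px|//] := boolP (x \in p.1).
  by rewrite mem_set//; exact: up _ _ Gxy px.
have [n1 n2 _] := midP np.
by have := IH _ n1; have := IH _ n2; lra.
Qed.

Lemma step_cauchy n k p x : nested p ->
  step n p x <= step (n + k) p x <= step n p x + 2 ^- n.
Proof.
elim: n p => [p np|n IH p np].
  have /andP[s0 s1] := step01 k p x; rewrite add0n /= indicE expr0 invr1.
  have [/set_mem px|_] := boolP (x \in p.1); last by rewrite add0r s0.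
  by rewrite step_in//= lexx/= ler_wpDl.
have [n1 n2 m21] := midP np; rewrite addSn /= pow2_half.
have [mx|nmx] := pselect ((mid p).1 x).
  (* on C' the lower half is complete: only the first pair matters *)
  rewrite [step (n + k) (_, p.2) x]step_in// [step n (_, p.2) x]step_in//.
  by have := IH _ n1; lra.
have nmx2 : ~ (mid p).2 x by move=> /m21.
rewrite [step (n + k) (p.1, _) x]step_out// [step n (p.1, _) x]step_out//.
by have := IH _ n2; lra.
Qed.

Lemma step_osc n p x : nested p ->
  \forall y \near x, `|step n p y - step n p x| <= 2 ^- n.
Proof.
elim: n p => [p np|n IH p np].
  apply: nearW => y; rewrite expr0 invr1 ler_norml.
  by have := step01 0 p x; have := step01 0 p y; lra.
have [n1 n2 m21] := midP np; rewrite pow2_half /=.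
have [mx|nmx] := pselect ((mid p).2 x).
  have nm : \forall y \near x, (mid p).2 y.
    by apply: open_nbhs_nbhs; split => //; case: n1.
  apply: filterS2 nm (IH _ n1) => y my.
  rewrite !(@step_in n ((mid p).1, p.2))//=; [|exact: m21..].
  by rewrite !ler_norml; lra.
have [mx|nmx1] := pselect ((mid p).1 x); last first.
  have nm : \forall y \near x, ~ (mid p).1 y.
    apply: (@open_nbhs_nbhs _ _ (~` (mid p).1)); split => //.
    by apply: closed_openC; case: n2.
  apply: filterS2 nm (IH _ n2) => y my.
  rewrite !(@step_out n (p.1, (mid p).2))//=; [|by move=> /m21..].
  by rewrite !ler_norml; lra.
(* between W' and C' the value is 1/2, the first half can only increase near x
   and the second only decrease: the two variations do not add up *)
apply: filterS2 (IH _ n1) (IH _ n2) => y.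
rewrite (@step_out n (p.1, _) x)// (@step_in n (_, p.2) x)//.
have := step01 n (p.1, (mid p).2) y; have := step01 n ((mid p).1, p.2) y.
by rewrite !ler_norml; lra.
Qed.

End step_functions.

(** Nachbin's separation theorem: Urysohn's lemma with a monotone function. *)
Lemma order_urysohn (C D : set T) :
  closed C -> up_closed G C -> closed D -> up_closed (G^-1)%relation D ->
  C `&` D = set0 ->
  exists u : T -> R, [/\ continuous u, forall x, 0 <= u x <= 1,
    forall x y, G (x, y) -> u x <= u y,
    forall x, C x -> u x = 1 & forall x, D x -> u x = 0].
Proof.
move=> cC upC cD downD CD0.
have nCD : nested (C, ~` D).
  split => //=; first exact: closed_openC.
    by move=> x y Gxy Dx Dy; apply: Dx; exact: downD _ _ Gxy Dy.
  by rewrite -disjoints_subset.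
have [mid midP] : exists mid, forall p, nested p ->
    [/\ nested (p.1, (mid p).2), nested ((mid p).1, p.2) &
        (mid p).2 `<=` (mid p).1].
  have /choice[mid midP] : forall p, exists q, nested p ->
      [/\ nested (p.1, q.2), nested (q.1, p.2) & q.2 `<=` q.1].
    move=> p; have [np|np] := pselect (nested p); last by exists p.
    by have [q qP] := up_closed_interpolate np; exists q.
  by exists mid.
have [u uP] := @dyadic_limit R T _
  (fun n k x => step_cauchy midP n k x nCD).
exists u; split.
- by apply: dyadic_limit_continuous uP _ => n x; exact: step_osc midP _ _ _ nCD.
- move=> x; apply/andP; split.
    have /andP[+ _] := uP 0%N x; apply: le_trans.
    by have /andP[] := step01 mid 0 (C, ~` D) x.
  apply: ler_addpow2 => n; have /andP[_ H] := uP n x.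
  by have /andP[_] := step01 mid n (C, ~` D) x; lra.
- move=> x y Gxy; apply: ler_addpow2 => n.
  have /andP[_ +] := uP n x; have /andP[+ _] := uP n y.
  by have := step_homo midP n nCD Gxy; lra.
- move=> x Cx; apply/eqP; rewrite eq_le; apply/andP; split.
    apply: ler_addpow2 => n; have /andP[_] := uP n x.
    by rewrite (step_in midP n nCD Cx).
  by have /andP[+ _] := uP 0%N x; rewrite (step_in midP 0 nCD Cx).
- move=> x Dx; have nDx : ~ (~` D) x by [].
  apply/eqP; rewrite eq_le; apply/andP; split.
    apply: ler_addpow2 => n; have /andP[_] := uP n x.
    by rewrite (step_out midP n nCD nDx).
  by have /andP[+ _] := uP 0%N x; rewrite (step_out midP 0 nCD nDx).
Qed.

End order_urysohn.

(** * Strictly monotone functions for a closed preorder *)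

Section dyadic_sum.
Context {R : realType} {T : topologicalType} (u : nat -> T -> R).
Hypothesis u01 : forall i x, 0 <= u i x <= 1.
Hypothesis uC : forall i, continuous (u i).

Let S (n : nat) (x : T) : R := \sum_(i < n) 2 ^- i.+1 * u i x.

Let SS n x : S n.+1 x = S n x + 2 ^- n / 2 * u n x.
Proof. by rewrite /S big_ord_recr /= pow2_half. Qed.

Let dyadic_sum_cauchy n k x : S n x <= S (n + k)%N x <= S n x + 2 ^- n.
Proof.
have p0 := @pow2_inv_gt0 R.
suff : S n x <= S (n + k)%N x <= S n x + 2 ^- n - 2 ^- (n + k).
  by have := p0 (n + k)%N; lra.
elim: k => [|k IH]; first by rewrite addn0; lra.
rewrite addnS SS pow2_half; have := p0 (n + k)%N.
by have /andP[u0 u1] := u01 (n + k) x; nra.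
Qed.

Let S_gap n (a b : nat -> R) i : (i < n)%N -> (forall j, a j <= b j) ->
  \sum_(j < n) 2 ^- j.+1 * a j + 2 ^- i.+1 * (b i - a i) <=
  \sum_(j < n) 2 ^- j.+1 * b j.
Proof.
move=> il ab; rewrite (bigD1 (Ordinal il))//= [leRHS](bigD1 (Ordinal il))//=.
rewrite addrAC -mulrDr addrCA subrr addr0 lerD2l.
by apply: ler_sum => j _; rewrite ler_pM2l ?pow2_inv_gt0.
Qed.

Let S_cst n (c : R) : \sum_(j < n) 2 ^- j.+1 * c = (1 - 2 ^- n) * c.
Proof.
elim: n => [|n IH]; first by rewrite big_ord0 expr0 invr1; lra.
by rewrite big_ord_recr /= IH pow2_half; lra.
Qed.

(** The last three clauses say that no strict inequality between terms is
    lost in the sum.  They compare partial sums with a gap 2 ^- i.+1 times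
    the difference of the i-th terms, a gap independent of the number of
    terms and hence inherited by the limit. *)
Lemma dyadic_sum : exists L : T -> R,
  (continuous L /\ forall x c, (forall i, u i x = c) -> L x = c) /\
  [/\
      forall x, 0 <= L x <= 1,
      forall x y, (forall i, u i x <= u i y) -> L x <= L y,
      forall x y i, (forall j, u j x <= u j y) -> u i x < u i y -> L x < L y,
      forall x i, u i x < 1 -> L x < 1 &
      forall x i, 0 < u i x -> 0 < L x].
Proof.
have [L LP] := dyadic_limit dyadic_sum_cauchy.
have SC n : continuous (S n).
  elim: n => [|n IH] x.
    rewrite (_ : S 0 = cst 0); first exact: cst_continuous.
    by apply/funext => y; rewrite /S big_ord0.
  rewrite (_ : S n.+1 = fun y => S n y + 2 ^- n / 2 * u n y).
    by apply: cvgD; [exact: IH|apply: cvgM; [exact: cvg_cst|exact: uC]].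
  by apply/funext => y; rewrite SS.
have S0 n x : 0 <= S n x.
  apply: sumr_ge0 => i _; have /andP[u0 _] := u01 i x.
  exact: mulr_ge0 (ltW (pow2_inv_gt0 _)) u0.
have Lmono x y : (forall i, u i x <= u i y) -> L x <= L y.
  move=> uxy; apply: ler_addpow2 => n.
  have /andP[_ Lx] := LP n x; have /andP[Ly _] := LP n y.
  have : S n x <= S n y.
    by apply: ler_sum => i _; rewrite ler_pM2l ?pow2_inv_gt0.
  by lra.
have Lcst x c : (forall i, u i x = c) -> L x = c.
  move=> uc; have Sc n : S n x = (1 - 2 ^- n) * c.
    by rewrite -S_cst; apply: eq_bigr => i _; rewrite uc.
  have /andP[c0 c1] : 0 <= c <= 1 by rewrite -(uc 0%N) u01.
  apply/eqP; rewrite eq_le; apply/andP; split; apply: ler_addpow2 => n;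
    have /andP[] := LP n x; rewrite Sc; have := @pow2_inv_gt0 R n; nra.
have small i n : 2 ^- (i.+1 + n) <= 2 ^- n :> R.
  by rewrite lef_pV2 ?posrE ?exprn_gt0// ler_weXn2l ?leq_addl ?ler1n.
exists L; split; [split => //|split => //].
- apply: dyadic_limit_continuous LP _ => n x.
  have /cvgrPdist_le/(_ _ (@pow2_inv_gt0 R n)) := SC n x.
  by apply: filterS => y; rewrite distrC.
- move=> x; apply/andP; split.
    by have /andP[+ _] := LP 0%N x; apply: le_trans.
  by have /andP[_] := LP 0%N x; rewrite /S big_ord0 expr0 invr1 add0r.
- move=> x y i uxy uixy.
  have d0 : 0 < 2 ^- i.+1 * (u i y - u i x).
    by rewrite mulr_gt0 ?pow2_inv_gt0 ?subr_gt0.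
  suff : L x + 2 ^- i.+1 * (u i y - u i x) <= L y by lra.
  apply: ler_addpow2 => n; have /andP[_ Lx] := LP (i.+1 + n)%N x.
  have /andP[Ly _] := LP (i.+1 + n)%N y.
  have := @S_gap (i.+1 + n) (u ^~ x) (u ^~ y) i (leq_addr _ _) uxy.
  by have := small i n; rewrite /= -/(S _ x) -/(S _ y); lra.
- move=> x i ux1.
  have d0 : 0 < 2 ^- i.+1 * (1 - u i x).
    by rewrite mulr_gt0 ?pow2_inv_gt0 ?subr_gt0.
  suff : L x + 2 ^- i.+1 * (1 - u i x) <= 1 by lra.
  apply: ler_addpow2 => n; have /andP[_ Lx] := LP (i.+1 + n)%N x.
  have ux j : u j x <= 1 by have /andP[] := u01 j x.
  have := @S_gap (i.+1 + n) (u ^~ x) (fun=> 1) i (leq_addr _ _) ux.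
  by have := @pow2_inv_gt0 R n; rewrite /= S_cst -/(S _ x); lra.
- move=> x i ux0; have /andP[+ _] := LP i.+1 x; apply: lt_le_trans.
  have ux j : 0 <= u j x by have /andP[] := u01 j x.
  have := @S_gap i.+1 (fun=> 0) (u ^~ x) i (leqnn _) ux.
  rewrite /= S_cst -/(S _ x); apply: lt_le_trans.
  by rewrite mulr0 add0r subr0 mulr_gt0 ?pow2_inv_gt0.
Qed.

End dyadic_sum.

Section strictly_monotone.
Context {R : realType} {X : metricType R} (G : set (X * X)) (A B : set X).
Hypothesis compactX : compact [set: X].
Hypotheses (closedG : closed G) (reflG : forall x, G (x, x)).
Hypothesis transG : forall x y z, G (x, y) -> G (y, z) -> G (x, z).
Hypotheses (closedA : closed A) (upA : up_closed G A).
Hypotheses (closedB : closed B) (downB : up_closed (G^-1)%relation B).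
Hypothesis AB0 : A `&` B = set0.

(** The condition on N and M says exactly that the increasing hull of the
    closure of N together with A, and the decreasing hull of the closure of
    M together with B, are disjoint.  When it fails, u only separates A from
    B, so that a family indexed by all pairs (N, M) can be summed. *)
Let separates (N M : set X) (u : X -> R) :=
  [/\ continuous u, forall x, 0 <= u x <= 1,
    forall x y, G (x, y) -> u x <= u y,
    forall x, A x -> u x = 1 & forall x, B x -> u x = 0] /\
  (closure N `<=` ~` B -> closure M `<=` ~` A ->
   (forall x y, closure N x -> closure M y -> ~ G (x, y)) ->
   (forall x, N x -> u x = 1) /\ (forall x, M x -> u x = 0)).

Let exists_separates (N M : set X) : exists u, separates N M u.
Proof.
have hX := @metric_hausdorff R X.
have [[NB MA NM]|bad] := pselect [/\ closure N `<=` ~` B, closure M `<=` ~` A &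
    forall x y, closure N x -> closure M y -> ~ G (x, y)]; last first.
  have [u uP] := @order_urysohn R X G compactX hX closedG reflG transG A B
    closedA upA closedB downB AB0.
  by exists u; split => // NB MA NM; exfalso; apply: bad.
pose C := A `|` rel_image G (closure N).
pose D := B `|` rel_image (G^-1)%relation (closure M).
have cC : closed C.
  by apply: closedU => //; apply: closed_rel_image => //; exact: closed_closure.
have cD : closed D.
  apply: closedU => //; apply: closed_rel_image => //; first exact: inv_closed.
  exact: closed_closure.
have upC : up_closed G C.
  move=> x y Gxy [Ax|[z Nz /xsectionP Gzx]]; first by left; exact: upA Gxy Ax.
  by right; exists z => //; apply/xsectionP; exact: transG Gzx Gxy.
have downD : up_closed (G^-1)%relation D.
  move=> x y Gyx [Bx|[z Nz /xsectionP Gxz]]; first by left; exact: downB Gyx Bx.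
  by right; exists z => //; apply/xsectionP; exact: transG Gyx Gxz.
have CD0 : C `&` D = set0.
  apply/seteqP; split => // x [[Ax|[z Nz /xsectionP Gzx]]].
    case=> [Bx|[y My /xsectionP/= Gxy]]; first by rewrite -AB0.
    by apply: (MA y) => //; exact: upA Gxy Ax.
  case=> [Bx|[y My /xsectionP/= Gxy]].
    by apply: (NB z) => //; apply: (downB _ Bx).
  exact: NM Nz My (transG Gzx Gxy).
have [u [uC u01 umono uA uB]] := @order_urysohn R X G compactX hX closedG reflG
  transG C D cC upC cD downD CD0.
exists u; split.
  split => // x ?; [exact/uA/or_introl|exact/uB/or_introl].
move=> _ _ _; split => x Nx; [apply: uA|apply: uB]; right; exists x;
  by [exact: subset_closure|exact/xsectionP].
Qed.

Let regular_nbhs (x : X) (P : set X) : nbhs x P ->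
  exists2 Q, nbhs x Q & closure Q `<=` P.
Proof. by move=> /(@uniform_regular X x)[Q xQ QP]; exists Q. Qed.

(** A strictly monotone function for a closed preorder, with prescribed
    extreme level sets.  If (y,x) is not in G, x is outside A and y is
    outside B, then these three open conditions persist on small closed
    neighborhoods N of y and M of x, so some term of the sum is 1 at y and 0
    at x. *)
Theorem strictly_monotone_function : exists L : X -> R,
  [/\ continuous L, forall x, 0 <= L x <= 1,
      B = L @^-1` [set 0], A = L @^-1` [set 1] &
      forall x y, G (x, y) -> L x <= L y /\
        (~ A x -> ~ B y -> ~ G (y, x) -> L x < L y)].
Proof.
have [e [e0 eP]] := compact_enum_basis compactX.
have ec x (P : set X) : nbhs x P -> exists n, e n x /\ closure (e n) `<=` P.
  move=> /regular_nbhs[Q xQ QP]; have [n [enx enQ]] := eP _ _ xQ.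
  by exists n; split => //; exact: subset_trans (closure_subset enQ) QP.
(* (0, 0) is a harmless value for the integers that code no pair *)
pose idx k := odflt (0, 0)%N (unpickle k : option (nat * nat)).
have [u uP] := choice (fun k => exists_separates (e (idx k).1) (e (idx k).2)).
have usep i j : exists k, separates (e i) (e j) (u k).
  by exists (pickle (i, j)); have := uP (pickle (i, j)); rewrite /idx pickleK.
have uC k : continuous (u k) by have [[]] := uP k.
have u01 k x : 0 <= u k x <= 1 by have [[]] := uP k.
have umono k x y : G (x, y) -> u k x <= u k y.
  by have [[_ _ + _ _] _] := uP k; exact.
have uA k x : A x -> u k x = 1 by have [[_ _ _ + _] _] := uP k; exact.
have uB k x : B x -> u k x = 0 by have [[_ _ _ _ +] _] := uP k; exact.
have [L [[LC Lcst] [L01 Lmono Lstrict L1 L0]]] := dyadic_sum u01 uC.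
have nA x : ~ A x -> nbhs x (~` A).
  by move=> Ax; apply: open_nbhs_nbhs; split => //; exact: closed_openC.
have nB x : ~ B x -> nbhs x (~` B).
  by move=> Bx; apply: open_nbhs_nbhs; split => //; exact: closed_openC.
exists L; split => //.
- apply/seteqP; split => x; first by move=> Bx; apply: Lcst => i; exact: uB.
  (* e 0 is empty: the only constraint is 1 near x *)
  move=> /= Lx; apply: contrapT => /nB/ec[n [enx enB]].
  have [k [_ []]] := usep n 0%N; rewrite ?e0 ?closure0//.
  by move=> /(_ x enx) ukx _; have := L0 x k; rewrite ukx Lx ltxx => /(_ ltr01).
- apply/seteqP; split => x; first by move=> Ax; apply: Lcst => i; exact: uA.
  move=> /= Lx; apply: contrapT => /nA/ec[n [enx enA]].
  have [k [_ []]] := usep 0%N n; rewrite ?e0 ?closure0//.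
  by move=> _ /(_ x enx) ukx; have := L1 x k; rewrite ukx Lx ltxx => /(_ ltr01).
move=> x y Gxy; split; first by apply: Lmono => i; exact: umono.
move=> Ax By Gyx.
have [[P Q] [/= yP xQ] PQ] : nbhs (y, x) (~` G).
  by apply: open_nbhs_nbhs; split => //; exact: closed_openC.
have [n [eny enP]] := ec _ _ (filterI yP (nB _ By)).
have [m [emx emQ]] := ec _ _ (filterI xQ (nA _ Ax)).
have [k [_ []]] := usep n m.
- by move=> z /enP[].
- by move=> z /emQ[].
- move=> z w /enP[Pz _] /emQ[Qw _]; exact: (PQ (z, w)).
move=> /(_ y eny) uky /(_ x emx) ukx; apply: (Lstrict x y k).
  by move=> j; exact: umono.
by rewrite uky ukx.
Qed.

End strictly_monotone.

(** * Iterates and chains of a closed relation *)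

Lemma rel_imageP {T : Type} (R : set (T * T)) (A : set T) y :
  rel_image R A y <-> exists2 x, A x & R (x, y).
Proof. by split=> -[x Ax /xsectionP Rxy]; exists x => //; exact/xsectionP. Qed.

Section iterates.
Context {T : Type}.
Implicit Types R S : set (T * T).

Lemma rel_iterD R m n x y z :
  rel_iter R m (x, y) -> rel_iter R n (y, z) -> rel_iter R (m + n)%N (x, z).
Proof.
move=> Rxy; elim: n z => [z /diagonalP <-|n IH z [w Rw Rwz]].
  by rewrite addn0.
by rewrite addnS; exists w => //; exact: IH.
Qed.

Lemma rel_iter1 R x y : rel_iter R 1 (x, y) <-> R (x, y).
Proof. by split=> [[z /= /diagonalP -> //]|Rxy]; exists x. Qed.

Lemma rel_image_iterS R n (U : set T) :
  rel_image (rel_iter R n.+1) U = rel_image R (rel_image (rel_iter R n) U).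
Proof.
apply/seteqP; split => y /rel_imageP[x].
  move=> Ux [z Rxz Rzy]; apply/rel_imageP; exists z => //.
  by apply/rel_imageP; exists x.
move=> /rel_imageP[z Uz Rzx] Rxy; apply/rel_imageP; exists z => //.
by exists x.
Qed.

Lemma rel_image_iter0 R (U : set T) : rel_image (rel_iter R 0) U = U.
Proof.
apply/seteqP; split => [y /rel_imageP[x Ux /diagonalP <- //]|x Ux].
by apply/rel_imageP; exists x.
Qed.

Lemma orbit_relW R x y : R (x, y) -> orbit_rel R (x, y).
Proof. by move=> Rxy; exists 1%N => //; exact/rel_iter1. Qed.

Lemma orbit_rel_trans R x y z :
  orbit_rel R (x, y) -> orbit_rel R (y, z) -> orbit_rel R (x, z).
Proof.
move=> [m m1 Rxy] [n n1 Ryz]; exists (m + n)%N; last exact: rel_iterD Rxy Ryz.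
by rewrite /= addn_gt0 m1.
Qed.

Lemma orbit_rel_last R x y : orbit_rel R (x, y) ->
  R (x, y) \/ exists2 z, orbit_rel R (x, z) & R (z, y).
Proof.
case=> -[//|[|n]] _ [z]; first by move=> /diagonalP <-; left.
by right; exists z => //; exists n.+1.
Qed.

Lemma orbit_rel_ind R (P : T -> Prop) x y :
  (forall z, R (x, z) -> P z) -> (forall z w, P z -> R (z, w) -> P w) ->
  orbit_rel R (x, y) -> P y.
Proof.
move=> P1 PS [n]; elim: n y => [//|[|n] IH] y _ [z].
  by move=> /diagonalP <-; exact: P1.
by move=> /(IH _ isT); exact: PS.
Qed.

Lemma orbit_rel_head R x y : orbit_rel R (x, y) ->
  R (x, y) \/ exists2 z, R (x, z) & orbit_rel R (z, y).
Proof.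
apply: (@orbit_rel_ind R (fun y => R (x, y) \/
  exists2 z, R (x, z) & orbit_rel R (z, y))); first by left.
move=> z w [Rxz|[v Rxv Rvz]] Rzw; right.
  by exists z => //; exact: orbit_relW.
by exists v => //; apply: orbit_rel_trans Rvz _; exact: orbit_relW.
Qed.

Lemma orbit_rel_sub R S : R `<=` S -> orbit_rel R `<=` orbit_rel S.
Proof.
move=> RS [x y].
apply: (@orbit_rel_ind R (fun y => orbit_rel S (x, y))) =>
  [z /RS|z w xz /RS Szw].
  exact: orbit_relW.
by apply: orbit_rel_trans xz _; exact: orbit_relW.
Qed.

End iterates.

Section chains.
Context {R : realType} {X : metricType R} (F : set (X * X)).
Implicit Types (e : R) (x y z w : X).

Lemma jumpP e x y :
  (mdist_rel e \; F)%relation (x, y) <-> exists2 z, F (x, z) & ball z e y.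
Proof.
by split=> -[z Fxz zy]; exists z => //; move: zy; rewrite ballEmdist.
Qed.

Lemma jump_le e d : e <= d ->
  (mdist_rel e \; F `<=` mdist_rel d \; F)%relation.
Proof.
move=> ed [x y] /jumpP[z Fxz zy]; apply/jumpP; exists z => //.
exact: le_ball zy.
Qed.

Lemma chainP x y : chain_rel F (x, y) <->
  forall e, 0 < e -> orbit_rel (mdist_rel e \; F)%relation (x, y).
Proof. by split=> H e; [exact: H|move=> /= e0; exact: H]. Qed.

Lemma chain_trans x y z :
  chain_rel F (x, y) -> chain_rel F (y, z) -> chain_rel F (x, z).
Proof.
move=> xy yz e e0; apply: orbit_rel_trans; [exact: xy|exact: yz].
Qed.

Lemma orbit_chain x y e : 0 < e ->
  orbit_rel F (x, y) -> orbit_rel (mdist_rel e \; F)%relation (x, y).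
Proof.
move=> e0; apply: orbit_rel_sub => -[z w] Fzw; apply/jumpP; exists w => //.
exact: ballxx.
Qed.

Lemma chainW x y : F (x, y) -> chain_rel F (x, y).
Proof. by move=> Fxy e e0; apply: orbit_chain => //; exact: orbit_relW. Qed.

(** Chains end with a jump, so moving the endpoint only costs a larger last
    jump. *)
Lemma chain_shift e d x y z : ball y d z ->
  orbit_rel (mdist_rel e \; F)%relation (x, y) ->
  orbit_rel (mdist_rel (e + d) \; F)%relation (x, z).
Proof.
move=> yz; have d0 : 0 < d.
  by move: yz; rewrite ballEmdist; apply: le_lt_trans; exact: mdist_ge0.
have jump v : (mdist_rel e \; F)%relation (v, y) ->
    (mdist_rel (e + d) \; F)%relation (v, z).
  move=> /jumpP[w Fvw wy]; apply/jumpP; exists w => //.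
  exact: ball_triangle wy yz.
have wide : e <= e + d by rewrite lerDl ltW.
move=> xy; have [{}xy|[v xv /jump vz]] := orbit_rel_last xy.
  by apply: orbit_relW; exact: jump.
apply: orbit_rel_trans (orbit_rel_sub (jump_le wide) xv) _.
exact: orbit_relW.
Qed.

Hypotheses (compactX : compact [set: X]) (closedF : closed F).

(** Closedness of F, as a statement about approximate images: if y is not in
    F(x), then F maps points near x away from y, uniformly. *)
Lemma far_from_image x y : ~ F (x, y) -> \forall x' \near x & e \near 0^'+,
  forall w, ball w e y -> ~ F (x', w).
Proof.
move=> Fxy.
have [[P Q] [/= xP /nbhs_ballP[d /= d0 dQ]] PQ] : nbhs (x, y) (~` F).
  by apply: open_nbhs_nbhs; split => //; exact: closed_openC.
exists (P, [set e | e < d]) => /=.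
  by split => //; exact: nbhs_right_lt.
move=> [x' e] /= [Px' ed] w we; apply: (PQ (x', w)); split => //=.
by apply: dQ; apply: ball_sym; exact: le_ball (ltW ed) _ we.
Qed.

(** Upper semicontinuity of x |-> F(x), which follows from closedness by
    compactness.  Lower semicontinuity fails in general: F(x) need not be
    approached by F(x'). *)
Lemma image_usc x e : 0 < e -> \forall x' \near x, forall z', F (x', z') ->
  exists2 z, F (x, z) & ball z e z'.
Proof.
move=> e0.
have H : \forall x' \near x, [set: X] `<=` (fun z' => F (x', z') ->
  exists2 z, F (x, z) & ball z e z').
  apply: (iffLR (compact_near_coveringP _) compactX) => z _.
  have [Fxz|Fxz] := pselect (F (x, z)).
    exists (ball z e, setT) => /=.
      by split; [exact: nbhsx_ballx|exact: filterT].
    by move=> [z' x'] /= [zz' _] _; exists z.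
  have [[P Q] [/= xP zQ] PQ] : nbhs (x, z) (~` F).
    by apply: open_nbhs_nbhs; split => //; exact: closed_openC.
  exists (Q, P) => //= -[z' x'] /= [Qz' Px'] Fx'z'.
  by exfalso; exact: (PQ (x', z')).
by apply: filterS H => x' H z'; exact: H.
Qed.

(** Moving the endpoint of a chain is absorbed by its last jump; moving its
    starting point is absorbed by its first jump, through upper
    semicontinuity. *)
Lemma closed_chain : closed (chain_rel F).
Proof.
move=> [x y] clxy; apply/chainP => e e0; have e4 : 0 < e / 4 by lra.
have nxy : nbhs (x, y) [set p | (forall z', F (p.1, z') ->
    exists2 z, F (x, z) & ball z (e / 4) z') /\ ball p.2 (e / 4) y].
  exists ([set x' | forall z', F (x', z') ->
    exists2 z, F (x, z) & ball z (e / 4) z'], ball y (e / 4)) => /=.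
    by split; [exact: image_usc|exact: nbhsx_ballx].
  by move=> [x' y'] /= [? ?]; split => //; exact: ball_sym.
have [[x' y'] [/chainP/(_ _ e4) x'y' [/= imx y'y]]] := clxy _ nxy.
have eE : e = e / 4 + e / 4 + (e / 4 + e / 4) by lra.
have jump v : (mdist_rel (e / 4) \; F)%relation (x', v) ->
    (mdist_rel (e / 4 + e / 4) \; F)%relation (x, v).
  move=> /jumpP[w /imx[z Fxz zw] wv]; apply/jumpP; exists z => //.
  exact: ball_triangle zw wv.
have [/jump x_y'|[v /jump xv vy']] := orbit_rel_head x'y'.
  apply: orbit_rel_sub (chain_shift y'y (orbit_relW x_y')).
  by apply: jump_le; lra.
apply: (@orbit_rel_trans _ _ _ v).
  by apply: orbit_rel_sub (orbit_relW xv); apply: jump_le; lra.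
by apply: orbit_rel_sub (chain_shift y'y vy'); apply: jump_le; lra.
Qed.

(** The last jump of a chain can be suppressed.  For small e the point from
    which the last F-step starts stays in a compact space; a cluster point z
    as e tends to 0 satisfies both conclusions, the first because small
    moves of the endpoint are absorbed by the last jump, the second because
    F is closed.  Here the existence of z is obtained by contradiction from
    a finite cover. *)
Lemma chain_last x y : chain_rel F (x, y) ->
  F (x, y) \/ exists2 z, chain_rel F (x, z) & F (z, y).
Proof.
move=> xy; apply: contrapT => /not_orP[Fxy nz].
have H : \forall e \near 0^'+, [set: X] `<=` (fun z =>
    ~ (orbit_rel (mdist_rel e \; F)%relation (x, z) /\
       (mdist_rel e \; F)%relation (z, y))).
  apply: (iffLR (compact_near_coveringP _) compactX) => z _.
  have [Fzy|Fzy] := pselect (F (z, y)); last first.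
    apply: filterS (far_from_image Fzy) => -[z' e] /= H [_ /jumpP[w Fzw wy]].
    exact: H Fzw.
  have /chainP/existsNP[e /not_implyP[e0 xz]] : ~ chain_rel F (x, z).
    by move=> xz; apply: nz; exists z.
  exists (ball z (e / 2), [set d | d < e / 2]) => /=.
    by split; [apply: nbhsx_ballx|apply: nbhs_right_lt]; lra.
  move=> [z' d] /= [zz' de] [xz' _]; apply: xz.
  have := chain_shift (ball_sym zz') xz'; apply: orbit_rel_sub.
  by apply: jump_le; lra.
have [[P Q] [/= xP eQ] PQ] := far_from_image Fxy.
have [e [[He Qe] e0]] :=
  @filter_ex _ _ (at_right_proper_filter (0 : R)) _
    (filterI (filterI H eQ) (nbhs_right_gt (0 : R))).
have [/jumpP[w Fxw wy]|[z xz zy]] := orbit_rel_last ((chainP x y).1 xy e e0).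
  by apply: (PQ (x, e)) wy Fxw; split => //; exact: nbhs_singleton.
exact: (He z).
Qed.

End chains.

(** * Attractors, repellers and chain recurrence *)

Section attractor.
Context {R : realType} {X : metricType R} (F : set (X * X)) (U : set X).
Hypotheses (compactX : compact [set: X]) (closedF : closed F).
Hypothesis inU : inward F U.
Implicit Types x y z : X.

Let iterU n := rel_image (rel_iter F n) U.

Let iterUS n y : iterU n.+1 y <-> exists2 x, iterU n x & F (x, y).
Proof. by rewrite /iterU rel_image_iterS; exact: rel_imageP. Qed.

Let iterU0 : iterU 0 = U. Proof. exact: rel_image_iter0. Qed.

Let closed_iterU n : closed (iterU n).
Proof.
elim: n => [|n IH]; first by rewrite iterU0; case: inU.
by rewrite /iterU rel_image_iterS; exact: closed_rel_image.
Qed.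

Let iterU_decr m n : (m <= n)%N -> iterU n `<=` iterU m.
Proof.
elim: n m => [|n IH] m; first by rewrite leqn0 => /eqP ->.
rewrite leq_eqVlt => /predU1P[-> //|]; rewrite ltnS => mn.
apply: subset_trans (IH _ mn) => {m mn}; elim: n {IH} => [|n IH] y /iterUS[x].
  rewrite iterU0 => Ux Fxy; apply: interior_subset; apply: inU.2.
  by apply/rel_imageP; exists x.
by move=> /IH Ux Fxy; apply/iterUS; exists x.
Qed.

(** The iterates decrease from U itself, so the index 0 may be included. *)
Lemma attractorP x : attractor_of F U x <-> forall n, iterU n x.
Proof.
split=> [Ax n|Ux n _]; last exact: Ux.
by apply: (iterU_decr (leqnSn n)); exact: Ax.
Qed.

Lemma attractor_sub : attractor_of F U `<=` U.
Proof. by move=> x /attractorP/(_ 0%N); rewrite iterU0. Qed.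

Lemma closed_attractor : closed (attractor_of F U).
Proof. by apply: closed_bigI => n _; exact: closed_iterU. Qed.

(** F(U) is compact inside the interior of U, which leaves a uniform room
    for jumps: small chains cannot leave U. *)
Let inward_margin : exists2 e : R, 0 < e &
  forall x y, U x -> (mdist_rel e \; F)%relation (x, y) -> U y.
Proof.
case: (inU) => cU FU.
have cFU : compact (rel_image F U).
  by apply: subclosed_compact compactX _ => //; exact: closed_rel_image.
have H : \forall e \near 0^'+, rel_image F U `<=` (fun w => ball w e `<=` U).
  apply: (iffLR (compact_near_coveringP _) cFU) => w /FU/nbhs_ballP[d /= d0 dU].
  exists (ball w (d / 2), [set e | e < d / 2]) => /=.
    by split; [apply: nbhsx_ballx|apply: nbhs_right_lt]; lra.
  move=> [w' e] /= [ww' ed] y w'y; apply: dU.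
  rewrite (splitr d); apply: ball_triangle ww' _.
  exact: le_ball (ltW ed) _ w'y.
have [e [He e0]] := @filter_ex _ _ (at_right_proper_filter (0 : R)) _
  (filterI H (nbhs_right_gt (0 : R))).
exists e => // x y Ux /jumpP[w Fxw wy]; apply: He wy.
by apply/rel_imageP; exists x.
Qed.

Let chain_inward x y : U x -> chain_rel F (x, y) -> U y.
Proof.
have [e e0 eU] := inward_margin => Ux /chainP/(_ e e0) xy.
apply: (@orbit_rel_ind _ (mdist_rel e \; F)%relation U x y) => // z.
exact: eU.
Qed.

(** A chain from a point of F^n(U) ends by an exact F-step starting, by
    induction, in F^n(U), so it gains one iterate. *)
Let chain_iterU n x y : iterU n x -> chain_rel F (x, y) -> iterU n.+1 y.
Proof.
elim: n x y => [|n IH] x y Ux xy; apply/iterUS;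
  have [Fxy|[z xz Fzy]] := chain_last compactX closedF xy.
- by exists x.
- by exists z => //; rewrite iterU0; apply: chain_inward xz; rewrite -iterU0.
- by exists x.
exists z => //; have /iterUS[u Uu Fux] := Ux.
by apply: IH Uu _; apply: chain_trans xz; exact: chainW.
Qed.

Lemma chain_attractor x y :
  attractor_of F U x -> chain_rel F (x, y) -> attractor_of F U y.
Proof.
move=> /attractorP Ux xy; apply/attractorP => n.
apply: (iterU_decr (leqnSn n)); exact: chain_iterU (Ux n) xy.
Qed.

(** A recurrent point of U climbs through all the iterates, along chains to
    itself. *)
Lemma chain_recurrent_attractor x :
  U x -> chain_rel F (x, x) -> attractor_of F U x.
Proof.
move=> Ux xx; apply/attractorP; elim=> [|n IH]; first by rewrite iterU0.
exact: chain_iterU IH xx.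
Qed.

(** Each F^n(U) contains a preimage of y; the preimages of y in these
    decreasing compact sets have a common point. *)
Lemma attractor_preimage y : attractor_of F U y ->
  exists2 x, attractor_of F U x & F (x, y).
Proof.
move=> /attractorP Ay; apply: contrapT => nx.
have : \forall n \near \oo, [set: X] `<=`
    (fun x => ~ (iterU n x /\ F (x, y))).
  apply: (iffLR (compact_near_coveringP _) compactX) => x _.
  have [Fxy|Fxy] := pselect (F (x, y)).
    have /existsNP[n Unx] : ~ forall n, iterU n x.
      by move=> Ux; apply: nx; exists x => //; exact/attractorP.
    exists (~` iterU n, [set m | (n <= m)%N]) => /=.
      split; last by exists n.
      by apply: open_nbhs_nbhs; split => //; exact/closed_openC/closed_iterU.
    by move=> [z m] /= [Unz nm] [/(iterU_decr nm)].
  have [[P Q] [/= xP yQ] PQ] : nbhs (x, y) (~` F).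
    by apply: open_nbhs_nbhs; split => //; exact: closed_openC.
  exists (P, setT) => /=; first by split => //; exact: filterT.
  move=> [z n] /= [Pz _] [_ Fzy]; apply: (PQ (z, y)) => //; split => //=.
  exact: nbhs_singleton.
move=> [n _ /(_ n (leqnn n))] H; have /iterUS[x Ux Fxy] := Ay n.+1.
by apply: (H x).
Qed.

End attractor.

Section repeller.
Context {R : realType} {X : metricType R} (F : set (X * X)) (U : set X).
Hypotheses (compactX : compact [set: X]) (closedF : closed F).
Hypothesis inU : inward F U.

(** The repeller is the attractor of the inverse relation for the
    complementary inward set. *)
Lemma inward_inv : inward (F^-1)%relation (~` U°).
Proof.
split; first exact/open_closedC/open_interior.
move=> x /rel_imageP[y Uy /= Fxy].
have : nbhs x (~` U).
  apply: open_nbhs_nbhs; split; first exact/closed_openC/inU.1.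
  by move=> Ux; apply/Uy/inU.2/rel_imageP; exists x.
by apply: filterS => z Uz /interior_subset.
Qed.

Lemma repellerE : repeller_of F U = attractor_of (F^-1)%relation (~` U°).
Proof. by []. Qed.

(** Reading a chain backwards exchanges steps and jumps: the reversed chain
    would begin with a jump.  Since the last F-step can be taken exact, the
    reversed chain begins with a step, and a trivial jump is added at its
    end. *)
Lemma chain_inv x y :
  chain_rel F (x, y) -> chain_rel (F^-1)%relation (y, x).
Proof.
have rev e z w v : 0 < e -> orbit_rel (mdist_rel e \; F)%relation (z, w) ->
    F (w, v) -> orbit_rel (mdist_rel e \; F^-1)%relation (v, z).
  move=> e0 zw; move: v; apply: (@orbit_rel_ind _ (mdist_rel e \; F)%relation
    (fun w => forall v, F (w, v) ->
      orbit_rel (mdist_rel e \; F^-1)%relation (v, z)) z w) zw => [w'|u w' IH];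
    move=> /jumpP[t Ft tw'] v Fw'v; (apply: (@orbit_rel_trans _ _ _ t);
      first by (apply/orbit_relW/jumpP; exists w' => //; exact: ball_sym)).
    by apply/orbit_relW/jumpP; exists z => //; exact: ballxx.
  exact: IH.
move=> xy; apply/chainP => e e0.
have [Fxy|[z xz Fzy]] := chain_last compactX closedF xy.
  by apply/orbit_relW/jumpP; exists x => //; exact: ballxx.
by apply: rev Fzy => //; exact: xz.
Qed.

End repeller.

Section attractor_repeller.
Context {R : realType} {X : metricType R} (F : set (X * X)) (A B : set X).
Hypotheses (compactX : compact [set: X]) (closedF : closed F).
Hypothesis pairAB : attractor_repeller_pair F A B.

Lemma attractor_repeller_props :
  [/\ closed A, closed B, A `&` B = set0,
    up_closed (chain_rel F) A & up_closed (chain_rel F)^-1%relation B] /\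
  [/\ forall y, A y -> exists2 x, A x & F (x, y),
      forall x, B x -> exists2 y, B y & F (x, y) &
      forall x, chain_rel F (x, x) -> A x \/ B x].
Proof.
case: pairAB => U [inU -> ->]; rewrite repellerE.
have inV := inward_inv inU; have cFV := inv_closed closedF.
split; split.
- exact: closed_attractor.
- exact: closed_attractor.
- apply/seteqP; split => // x [Ax Bx].
  have [y Ay Fyx] := attractor_preimage compactX closedF inU Ax.
  apply: (attractor_sub inV Bx); apply: inU.2; apply/rel_imageP.
  by exists y => //; exact: attractor_sub Ay.
- move=> x y xy Ax; exact: chain_attractor Ax xy.
- move=> x y /(chain_inv compactX closedF) xy Bx.
  exact: chain_attractor Bx xy.
- move=> y; exact: attractor_preimage.
- move=> x Bx; have [y By Fyx] := attractor_preimage compactX cFV inV Bx.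
  by exists y.
move=> x xx; have [Ux|Ux] := pselect (U x); [left|right].
  exact: chain_recurrent_attractor xx.
apply: chain_recurrent_attractor (chain_inv compactX closedF xx) => //.
by move/interior_subset.
Qed.

End attractor_repeller.

(** * The preorder generated by a semiflow relation *)

Lemma closed_times_rel {R : realType} {X : topologicalType}
    (Phi : set (X * R * X)) (K : set R) :
  compact K -> closed Phi -> closed (times_rel Phi K).
Proof.
move=> cK cPhi.
have cS : closed [set p : R * (X * X) | Phi (p.2.1, p.1, p.2.2)].
  have /continuous_closedP/(_ _ cPhi) : continuous
    (fun p : R * (X * X) => (p.2.1, p.1, p.2.2)); last by [].
  move=> p.
  have c1 : q.2.1 @[q --> p] --> p.2.1.
    by apply: (@cvg_comp _ _ _ snd fst); [exact: cvg_snd|exact: cvg_fst].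
  have c2 : q.2.2 @[q --> p] --> p.2.2.
    by apply: (@cvg_comp _ _ _ snd snd); [exact: cvg_snd|exact: cvg_snd].
  have c0 : q.1 @[q --> p] --> p.1 by exact: cvg_fst.
  exact: (cvg_pair (cvg_pair c1 c0) c2).
have := closed_compact_proj cK cS; congr (closed _).
Qed.

Section semiflow.
Context {R : realType} {X : metricType R} (Phi : set (X * R * X)).
Hypotheses (compactX : compact [set: X]) (sPhi : semiflow_relation Phi).
Implicit Types (x y z : X) (s t : R).

Local Notation F := (times_rel Phi `[1, 2]).
Local Notation CF := (chain_rel F).
Local Notation G := (times_rel Phi `[0, 1] `|` CF).

Lemma semiflow0 x y : Phi (x, 0, y) <-> x = y.
Proof.
have : time_rel Phi 0 (x, y) <-> diagonal (x, y) by rewrite semiflow_time0.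
by move=> H; split => [/H|] //= xy; exact/H.
Qed.

Lemma semiflow_comp s t x y z :
  Phi (x, s, y) -> Phi (y, t, z) -> Phi (x, s + t, z).
Proof.
move=> xy yz; have s0 := semiflow_time_ge0 sPhi xy.
have t0 := semiflow_time_ge0 sPhi yz.
suff : time_rel Phi (s + t) (x, z) by [].
by rewrite addrC -(semiflow_timeD sPhi t0 s0); exists y.
Qed.

Lemma semiflow_split s t x z : 0 <= s -> 0 <= t -> Phi (x, s + t, z) ->
  exists2 y, Phi (x, s, y) & Phi (y, t, z).
Proof.
move=> s0 t0 xz; have : time_rel Phi (s + t) (x, z) by [].
by rewrite addrC -(semiflow_timeD sPhi t0 s0) => -[y xy yz]; exists y.
Qed.

Lemma closed_times_rel12 : closed F.
Proof.
by apply: closed_times_rel (semiflow_closed sPhi); exact: segment_compact.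
Qed.

Lemma times_rel12 x y t : 1 <= t <= 2 -> Phi (x, t, y) -> F (x, y).
Proof. by move=> t12 xy; exists t => //=; rewrite in_itv. Qed.

(** Pieces of length 1 are cut off until the remaining length is in [1,2]. *)
Lemma orbit_semiflow x y t : 1 <= t -> Phi (x, t, y) -> orbit_rel F (x, y).
Proof.
move=> t1; have [n tn] : exists n, t <= n%:R + 2.
  exists (Num.truncn t); have := truncnS_gt t; rewrite -natr1; lra.
elim: n x t t1 tn => [|n IH] x t t1 tn xy.
  by apply: orbit_relW; apply: times_rel12 xy; lra.
have [t2|t2] := leP t 2; first by apply: orbit_relW; apply: times_rel12 xy; lra.
have [||z xz zy] := @semiflow_split 1 (t - 1) x y ler01.
- by lra.
- by rewrite addrC subrK.
apply: (@orbit_rel_trans _ _ _ z).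
  by apply: orbit_relW; apply: times_rel12 xz; lra.
by apply: IH zy; [lra|move: tn; rewrite -natr1; lra].
Qed.

Lemma chain_semiflow x y t : 1 <= t -> Phi (x, t, y) -> CF (x, y).
Proof.
move=> t1 /(orbit_semiflow t1) xy; apply/chainP => e e0; exact: orbit_chain.
Qed.

(** The orbit piece merges with the first F-step of the chain into an orbit
    piece of length at least 1. *)
Lemma semiflow_chain x y z t : Phi (x, t, y) -> CF (y, z) -> CF (x, z).
Proof.
move=> xy yz; have t0 := semiflow_time_ge0 sPhi xy.
have long w : F (y, w) -> orbit_rel F (x, w).
  move=> [s]; rewrite /= in_itv /= => /andP[s1 _] yw.
  by apply: (@orbit_semiflow _ _ (t + s)); [lra|exact: semiflow_comp yw].
apply/chainP => e e0; have e2 : 0 < e / 2 by lra.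
have jump w : (mdist_rel (e / 2) \; F)%relation (y, w) ->
    orbit_rel (mdist_rel e \; F)%relation (x, w).
  move=> /jumpP[v /long/(orbit_chain e2) xv vw].
  by have := chain_shift vw xv; rewrite -splitr.
have [/jump //|[w /jump xw wz]] := orbit_rel_head ((chainP _ _ _).1 yz _ e2).
apply: orbit_rel_trans xw _; apply: orbit_rel_sub wz; apply: jump_le; lra.
Qed.

(** The last jump of the chain stands between the last F-step and the orbit
    piece, and a semiflow relation is not lower semicontinuous, so the piece
    cannot be moved across the jump; [chain_last] removes the jump instead. *)
Lemma chain_then_semiflow x y z t : CF (x, y) -> Phi (y, t, z) -> CF (x, z).
Proof.
move=> xy yz; have t0 := semiflow_time_ge0 sPhi yz.
have long w : F (w, y) -> CF (w, z).
  move=> [s]; rewrite /= in_itv /= => /andP[s1 _] wy.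
  by apply: (@chain_semiflow _ _ (s + t)); [lra|exact: semiflow_comp yz].
have [/long //|[w xw /long]] := chain_last compactX closed_times_rel12 xy.
exact: chain_trans.
Qed.

Lemma flow_or_chain_trans x y z : G (x, y) -> G (y, z) -> G (x, z).
Proof.
move=> [[s s01 xy]|xy] [[t t01 yz]|yz].
- move: s01 t01; rewrite /= !in_itv /= => /andP[s0 s1] /andP[t0 t1].
  have xz := semiflow_comp xy yz.
  have [st|/ltW st] := leP (s + t) 1; last by right; exact: chain_semiflow xz.
  by left; exists (s + t) => //=; rewrite in_itv /=; lra.
- by right; exact: semiflow_chain xy yz.
- by right; exact: chain_then_semiflow xy yz.
- by right; exact: chain_trans xy yz.
Qed.

Lemma flow_or_chain_refl x : G (x, x).
Proof.
by left; exists 0; [rewrite /= in_itv /= lexx ler01|exact/semiflow0].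
Qed.

Lemma closed_flow_or_chain : closed G.
Proof.
apply: closedU; last exact: closed_chain compactX closed_times_rel12.
by apply: closed_times_rel (semiflow_closed sPhi); exact: segment_compact.
Qed.

Lemma semiflow_flow_or_chain x y t : Phi (x, t, y) -> G (x, y).
Proof.
move=> xy; have t0 := semiflow_time_ge0 sPhi xy.
have [t1|/ltW t1] := leP t 1; last by right; exact: chain_semiflow xy.
by left; exists t => //=; rewrite in_itv /= t0.
Qed.

(** Turn around the periodic orbit until the total time exceeds 1. *)
Lemma periodic_chain_recurrent x t : 0 < t -> Phi (x, t, x) -> CF (x, x).
Proof.
move=> t0 xx; pose n := Num.truncn t^-1.
apply: (@chain_semiflow _ _ (t *+ n.+1)).
  have : t^-1 < n.+1%:R by exact: truncnS_gt.
  by rewrite -(ltr_pM2l t0) divff ?gt_eqF// -[t *+ _]mulr_natr => /ltW.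
elim: n => [|n IH]; first by rewrite mulr1n.
by rewrite mulrS; exact: semiflow_comp IH.
Qed.

(** The hypothesis x <> y excludes two orbit pieces of length 0. *)
Lemma flow_or_chain_recurrent x y :
  G (x, y) -> G (y, x) -> x <> y -> CF (x, x).
Proof.
move=> [[s s01 xy]|xy] [[t t01 yx]|yx] xDy.
- have s0 := semiflow_time_ge0 sPhi xy; have t0 := semiflow_time_ge0 sPhi yx.
  apply: (@periodic_chain_recurrent x (s + t)); last exact: semiflow_comp yx.
  rewrite lt_neqAle addr_ge0 // andbT eq_sym paddr_eq0 //.
  apply/negP => /andP[/eqP s00 _]; apply: xDy.
  by apply/semiflow0; rewrite -s00.
- exact: semiflow_chain xy yx.
- exact: chain_then_semiflow xy yx.
- exact: chain_trans xy yx.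
Qed.

End semiflow.

(** * The Lyapunov function of an attractor-repeller pair *)

(** A bound m strictly below c turns pointwise strict inequalities into a
    strict inequality for the supremum, with no exception for the empty set. *)
Lemma compact_lt_bound {R : realType} {X : topologicalType} (L : X -> R)
    (P : set X) (c : R) :
  compact [set: X] -> continuous L -> closed P -> (forall x, P x -> L x < c) ->
  exists2 m, m < c & forall x, P x -> L x <= m.
Proof.
move=> cX LC cP Lc; have [P0|/set0P/negP/negPn/eqP P0] := pselect (P !=set0).
  have cPc : compact P by exact: subclosed_compact cX _.
  have [x /set_mem Px Lx] := compact_EVT_max P0 cPc (continuous_subspaceT LC).
  by exists (L x); [exact: Lc|move=> y Py; apply: Lx; rewrite inE].
by exists (c - 1); [lra|rewrite P0].
Qed.

Lemma compact_gt_bound {R : realType} {X : topologicalType} (L : X -> R)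
    (P : set X) (c : R) :
  compact [set: X] -> continuous L -> closed P -> (forall x, P x -> c < L x) ->
  exists2 m, c < m & forall x, P x -> m <= L x.
Proof.
move=> cX LC cP Lc.
have [||m mc mP] := @compact_lt_bound R X (fun x => - L x) P (- c) cX _ cP.
- by move=> x; apply: cvgN; exact: LC.
- by move=> x Px; rewrite ltrN2; exact: Lc.
exists (- m); first by rewrite ltrNr.
by move=> x /mP; rewrite lerNl.
Qed.

Lemma closed_xsection {R : realType} {X : metricType R} (Q : set (X * X)) x :
  compact [set: X] -> closed Q -> closed (xsection Q x).
Proof.
move=> cX cQ; rewrite -(bigcup_set1 (xsection Q)).
apply: closed_rel_image => //; apply: compact_closed; last exact: compact_set1.
exact: metric_hausdorff.
Qed.

(** Off E the strict inequalities pass to the supremum and the infimum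
    because the sections of Q are compact; on E one witness breaks the
    inequality. *)
Lemma critical_points_eq {R : realType} {X : metricType R}
    (Q : set (X * X)) (L : X -> R) (E : set X) :
  compact [set: X] -> closed Q -> continuous L ->
  (forall x, E x -> (exists2 y, Q (x, y) & L y <= L x) \/
                    (exists2 y, Q (y, x) & L x <= L y)) ->
  (forall x y, ~ E x \/ ~ E y -> Q (x, y) -> L x < L y) ->
  critical_points Q L = E.
Proof.
move=> cX cQ LC EQ QE; apply/seteqP; split => x; last first.
  move=> /EQ [[y Qxy Lyx]|[y Qyx Lxy]] [supx infx].
    move: infx; apply/negP; rewrite -leNgt; apply: ge_ereal_inf.
    by exists (L y)%:E; [exists y => //; exact/xsectionP|rewrite lee_fin].
  move: supx; apply/negP; rewrite -leNgt; apply: le_ereal_sup_tmp.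
  by exists (L y)%:E; [exists y => //; exact/xsectionP|rewrite lee_fin].
apply: contra_notP => Ex; split.
  have [|m mx mP] := @compact_lt_bound R X L (xsection (Q^-1)%relation x) (L x)
    cX LC (closed_xsection cX (inv_closed cQ)).
    by move=> y /xsectionP Qyx; apply: QE => //; right.
  apply: (@le_lt_trans _ _ m%:E); last by rewrite lte_fin.
  by apply: ge_ereal_sup => _ [y /mP Ly <-]; rewrite lee_fin.
have [|m mx mP] := @compact_gt_bound R X L (xsection Q x) (L x)
  cX LC (closed_xsection cX cQ).
  by move=> y /xsectionP Qyx; apply: QE => //; left.
apply: (@lt_le_trans _ _ m%:E); first by rewrite lte_fin.
by apply: le_ereal_inf_tmp => _ [y /mP Ly <-]; rewrite lee_fin.
Qed.

(** Let y minimize L on the attractor of the superlevel set.  It has a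
    preimage z in that attractor, so L y <= L z, which forces y into A; as A
    is a top level set, the whole attractor lies in A. *)
Lemma attractor_superlevel {R : realType} {X : metricType R} (F : set (X * X))
    (A : set X) (L : X -> R) (a : R) :
  compact [set: X] -> closed F -> continuous L ->
  inward F [set x | a <= L x] ->
  (forall y, A y -> exists2 x, A x & F (x, y)) ->
  (forall x, A x -> a <= L x) ->
  (forall x y, a <= L x -> F (x, y) -> L y <= L x -> A y) ->
  (forall x y, A x -> L x <= L y -> A y) ->
  attractor_of F [set x | a <= L x] = A.
Proof.
move=> cX cF LC inU AF Aa stopA topA; set U := [set x | a <= L x].
apply/seteqP; split => x; last first.
  move=> Ax n _; elim: n x Ax => [|n IH] x Ax.
    by rewrite rel_image_iter0; exact: Aa.
  have [y Ay Fyx] := AF _ Ax; rewrite rel_image_iterS; apply/rel_imageP.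
  by exists y => //; exact: IH.
move=> A'x.
have cA' : compact (attractor_of F U).
  apply: (subclosed_compact _ cX) => //; exact: closed_attractor.
have [y /set_mem A'y ymin] := compact_EVT_min (ex_intro _ x A'x) cA'
  (continuous_subspaceT LC).
have [z A'z Fzy] := attractor_preimage cX cF inU A'y.
have Ay : A y.
  apply: stopA Fzy _; first exact: attractor_sub A'z.
  by apply: ymin; rewrite inE.
by apply: topA Ay _; apply: ymin; rewrite inE.
Qed.

Theorem corollary3p14 (R : realType) (X : metricType R)
    (compactX : compact [set: X])
    (Phi : set (X * R * X)) (semiflowPhi : semiflow_relation Phi)
    (A B : set X)
    (pairAB : attractor_repeller_pair (times_rel Phi `[1, 2]) A B) :
  exists L : X -> R,
    [/\ continuous L /\ (forall x, 0 <= L x <= 1),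
        B = L @^-1` [set 0] /\ A = L @^-1` [set 1],
        (forall x y,
           (times_rel Phi `[0, 1] `|` chain_rel (times_rel Phi `[1, 2])) (x, y) ->
           x <> y ->
           L x <= L y /\ (L y = L x -> (A x /\ A y) \/ (B x /\ B y))),
        lyapunov (chain_rel (times_rel Phi `[1, 2])) L /\
        critical_points (chain_rel (times_rel Phi `[1, 2])) L = A `|` B &
        (forall a : R, 0 < a < 1 ->
           semiflow_inward Phi [set x | a <= L x] /\
           attractor_of (times_rel Phi `[1, 2]) [set x | a <= L x] = A) /\
        (forall V : set X, A `<=` V° ->
           exists a : R, 0 < a < 1 /\ [set x | a <= L x] `<=` V)].
Proof.
set F := times_rel Phi `[1, 2]; set G := times_rel Phi `[0, 1] `|` chain_rel F.
have cF : closed F := closed_times_rel12 semiflowPhi.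
have [[cA cB AB0 chainA chainB] [preA postB recAB]] :=
  attractor_repeller_props compactX cF pairAB.
have upA : up_closed G A.
  move=> x y [[t _ xy]|xy] Ax; last exact: chainA xy Ax.
  have [w Aw Fwx] := preA _ Ax; apply: (chainA w y) => //.
  exact: chain_then_semiflow (chainW Fwx) xy.
have downB : up_closed (G^-1)%relation B.
  move=> x y [[t _ yx]|yx] Bx; last exact: chainB yx Bx.
  have [w Bw Fxw] := postB _ Bx; apply: (chainB w y) => //.
  exact: semiflow_chain yx (chainW Fxw).
have [L [LC L01 BE AE LG]] := strictly_monotone_function compactX
  (closed_flow_or_chain compactX semiflowPhi)
  (flow_or_chain_refl semiflowPhi)
  (flow_or_chain_trans compactX semiflowPhi) cA upA cB downB AB0.
have Lmono x y : G (x, y) -> L x <= L y by move=> /LG[].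
have A1 x : A x <-> L x = 1 by rewrite AE.
have B0 x : B x <-> L x = 0 by rewrite BE.
have level x y : G (x, y) -> L y = L x ->
    [\/ x = y, A x /\ A y | B x /\ B y].
  move=> xy Lyx; have [->|xDy] := pselect (x = y); first exact: Or31.
  have [Ax|nAx] := pselect (A x).
    by apply: Or32; split => //; exact: upA Ax.
  have [By|nBy] := pselect (B y).
    by apply: Or33; split => //; exact: downB By.
  have [yx|nyx] := pselect (G (y, x)); last first.
    have [_ /(_ nAx nBy nyx)] := LG _ _ xy; rewrite Lyx ltxx //.
  have xx := flow_or_chain_recurrent compactX semiflowPhi xy yx xDy.
  have [//|Bx] := recAB _ xx; apply: Or33; split => //; exact: downB yx Bx.
have strict x y : chain_rel F (x, y) \/ (exists2 t, 0 < t & Phi (x, t, y)) ->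
    [\/ L x < L y, A x /\ A y | B x /\ B y].
  move=> xy; have Gxy : G (x, y).
    by case: xy => [|[t _ /(semiflow_flow_or_chain semiflowPhi)//]]; right.
  have := Lmono _ _ Gxy; rewrite le_eqVlt => /predU1P[Lxy|]; last exact: Or31.
  have [xEy|AA|BB] := level _ _ Gxy (esym Lxy); [|exact: Or32|exact: Or33].
  have xx : chain_rel F (x, x).
    case: xy => [|[t t0]]; rewrite -xEy //.
    exact: periodic_chain_recurrent.
  by rewrite -xEy; case: (recAB _ xx) => ?; [apply: Or32|apply: Or33].
exists L; split=> //.
- move=> x y xy xDy; split; first exact: Lmono.
  by move=> /(level _ _ xy)[//|?|?]; [left|right].
- split; first by split => // x y xy; apply: Lmono; right.
  apply: critical_points_eq => //; first exact: closed_chain.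
    move=> x [Ax|Bx]; [right|left].
      have [y Ay yx] := preA _ Ax; exists y; first exact: chainW.
      by rewrite ((A1 _).1 Ax) ((A1 _).1 Ay).
    have [y By xy] := postB _ Bx; exists y; first exact: chainW.
    by rewrite ((B0 _).1 Bx) ((B0 _).1 By).
  move=> x y nE xy; have [//|[Ax Ay]|[Bx By]] := strict x y (or_introl xy).
    by case: nE => nE; exfalso; apply: nE; left.
  by case: nE => nE; exfalso; apply: nE; right.
split=> [a /andP[a0 a1]|V AV].
  have cU : closed [set x | a <= L x].
    have /continuous_closedP/(_ _ (@closed_ge _ a)) := LC; exact.
  have intU x : a < L x -> [set x | a <= L x]° x.
    move=> ax; have : nbhs x (L @^-1` [set r | a < r]).
      by apply: LC; apply: open_nbhs_nbhs; split => //; exact: open_gt.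
    by apply: filterS => y /= /ltW.
  have sU : semiflow_inward Phi [set x | a <= L x].
    split => // t t0 y /rel_imageP[x /= ax xy]; apply: intU.
    have [/(le_lt_trans ax)//|[_ /A1 ->]//|[/B0 Bx _]] :=
      strict x y (or_intror (ex_intro2 _ _ t t0 xy)).
    by move: ax; rewrite Bx leNgt a0.
  split => //; apply: attractor_superlevel => //.
  - split => // y /rel_imageP[x ax [t t12 xy]]; apply: (sU.2 t).
      by move: t12; rewrite /= in_itv /= => /andP[t1 _]; lra.
    by apply/rel_imageP; exists x.
  - by move=> x /A1 ->; exact: ltW.
  - move=> x y ax Fxy; rewrite leNgt => Lyx.
    have [Lxy|[]//|[/B0 Bx _]] := strict x y (or_introl (chainW Fxy)).
      by rewrite Lxy in Lyx.
    by move: ax; rewrite Bx leNgt a0.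
  - move=> x y /A1 Lx; rewrite Lx => Ly; apply/A1/eqP; rewrite eq_le Ly andbT.
    by have /andP[] := L01 y.
have [||m m1 mP] := @compact_lt_bound R X L (~` V°) 1 compactX LC _ _.
- exact/open_closedC/open_interior.
- move=> x nVx; have /andP[_] := L01 x; rewrite le_eqVlt => /predU1P[Lx|//].
  by exfalso; apply/nVx/AV/A1.
(* the maximum with 0 keeps a positive when the complement of V is empty *)
pose a := (Num.max m 0 + 1) / 2.
have m0 : 0 <= Num.max m 0 by rewrite le_max lexx orbT.
have mm : m <= Num.max m 0 by rewrite le_max lexx.
have m01 : Num.max m 0 < 1 by rewrite gt_max m1 ltr01.
exists a; split; first by rewrite /a; lra.
move=> x /= ax; apply: interior_subset; apply: contrapT => /mP.
by rewrite /a in ax; lra.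
Qed.
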